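(* Let $\Omega$ be a finite ground set, $f:2^\Omega\to\mathbb{R}_{\ge0}$ a (possibly nonmonotone) submodular function, $\rho$ a routing-based cost function on $2^\Omega$, $\mathbf{c}>0$ a budget, $\theta>0$, and $\hat\rho$ a $(1+\theta)$-approximation algorithm for $\rho$. Fix $S\subseteq\Omega$ and run one iteration of the two-stage procedure below on $S$. Let $X^{\rho}$ be the output of the greedy loop on $S$ with evaluator $\rho$ and budget $\mathbf{c}$. Then $X^\rho$ is one of the sets to which USM is applied in Stage 2 of this iteration; consequently a subset of $X^\rho$ (the output of USM on $X^\rho$) is placed into the candidate collection $\mathcal{T}$.
   Context: $f$ is submodular: $f(A\cup B)+f(A\cap B)\le f(A)+f(B)$ for all $A,B\subseteq\Omega$; $f^+_A(x)=f(A\cup\{x\})-f(A)$. Routing-based cost function: items of $\Omega$ are vertices of a weighted graph with visiting costs $c_s\ge0$ and positive edge weights, $\rho(S')=\sum_{s\in S'}c_s+r^*(S')$ with $r^*(S')$ the minimum cost of a route traversing each vertex of $S'$ at least once; $\rho(\emptyset)=0$, $\rho$ nondecreasing. $\hat\rho$ satisfies $\rho(S')\le\hat\rho(S')\le(1+\theta)\rho(S')$ for all $S'$. Greedy loop on $S$ with evaluator $C$ and budget $B$: start with empty sequence $X$ and $R=S$; while $R\ne\emptyset$, let $s^*=\arg\max\{f^+_X(s):s\in R\}$ (fixed tie-breaking independent of $C$); if $C(X\cup\{s^*\})\le B$ append $s^*$ to $X$ and remove it from $R$, else stop. USM denotes an algorithm for unconstrained (nonmonotone) submodular maximization that, given a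 set $X$, outputs a subset of $X$. Two-stage procedure on $S$: Stage 1 runs the greedy loop with evaluator $\hat\rho$ and budget $(1+\theta)\mathbf{c}$, producing the sequence $X$, and additionally maintains a sequence $Y$ (initially empty): whenever $s^*$ is appended to $X$ and afterwards $\hat\rho(X)>\mathbf{c}$, $s^*$ is also appended to $Y$. Stage 2 (if $X\ne\emptyset$): compute $T^*=\mathrm{USM}(X)$; then while $Y$ is nonempty, let $y$ be the last item of $Y$, remove $y$ from both $X$ and $Y$, and add $\mathrm{USM}(X)$ (applied to the current $X$) to the collection $\mathcal{T}$; finally add $T^*$ to $\mathcal{T}$.
   Formalization: The formal theorem assumes that the Stage 1 sequence X is nonempty, so that Stage 2 is run; if X is empty (e.g. S empty, or the first item exceeds the budget), USM is never applied and the claim as worded fails. *)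

(* Defs.v *)
From HB Require Import structures.
From mathcomp Require Import all_boot all_order all_algebra.
From mathcomp Require Import reals.

Set Implicit Arguments.
Unset Strict Implicit.
Unset Printing Implicit Defensive.

Import Order.TTheory GRing.Theory Num.Theory.

Local Open Scope ring_scope.

Definition submodular (R : realType) (Omega : finType) (f : {set Omega} -> R) :=
  forall A B : {set Omega}, f (A :|: B) + f (A :&: B) <= f A + f B.

Definition marginal (R : realType) (Omega : finType) (f : {set Omega} -> R)
    (A : {set Omega}) (x : Omega) : R :=
  f (A :|: [set x]) - f A.

(* An undirected weighted graph.  Items are vertices through the injection
   [loc]; the graph may have further vertices that are not items. *)
Record routing_graph (R : realType) (Omega : finType) := RoutingGraph {
  vertex : finType;
  loc : Omega -> vertex;
  adj : rel vertex;
  weight : vertex -> vertex -> R;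
  visit_cost : Omega -> R;
  loc_inj : injective loc;
  adj_sym : symmetric adj;
  weight_sym : forall x y, weight x y = weight y x;
  weight_gt0 : forall x y, adj x y -> 0 < weight x y;
  visit_cost_ge0 : forall s, 0 <= visit_cost s
}.

Section Routes.
Variables (R : realType) (Omega : finType) (G : routing_graph R Omega).

(* A route is a walk in the graph; it may repeat vertices and edges, and the
   empty walk is a route covering the empty set. *)
Definition is_route (p : seq (vertex G)) : bool := sorted (@adj _ _ G) p.

Definition covers (p : seq (vertex G)) (A : {set Omega}) : Prop :=
  forall s, s \in A -> loc G s \in p.

Definition route_cost (p : seq (vertex G)) : R :=
  \sum_(xy <- zip p (behead p)) weight xy.1 xy.2.

Definition min_route_cost (A : {set Omega}) (r : R) : Prop :=
  (exists p, [/\ is_route p, covers p A & route_cost p = r]) /\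
  (forall p, is_route p -> covers p A -> r <= route_cost p).

(* The existence of a real minimum for every [A] makes all items mutually
   reachable in the graph. *)
Definition routing_cost (rho : {set Omega} -> R) : Prop :=
  forall A : {set Omega}, exists2 r, min_route_cost A r
    & rho A = \sum_(s in A) visit_cost G s + r.

End Routes.

Definition approximates (R : realType) (Omega : finType) (theta : R)
    (rho rho_hat : {set Omega} -> R) : Prop :=
  forall A, rho A <= rho_hat A <= (1 + theta) * rho A.

(* [sel X E] is the item chosen when the current sequence is [X] and the
   remaining items are [E]: a maximizer of the marginal gain, with ties resolved
   by an arbitrary fixed rule.  It does not depend on any cost evaluator. *)
Definition greedy_selection (R : realType) (Omega : finType)
    (f : {set Omega} -> R) (sel : seq Omega -> {set Omega} -> Omega) : Prop :=
  forall (X : seq Omega) (E : {set Omega}), E != set0 ->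
    sel X E \in E /\
    (forall s, s \in E ->
       marginal f [set x in X] s <= marginal f [set x in X] (sel X E)).

Section Procedure.
Variables (R : realType) (Omega : finType).
Variable sel : seq Omega -> {set Omega} -> Omega.

(* [n] bounds the number of rounds; each round either stops or removes an item
   from [E], so [n = #|E|] rounds suffice. *)
Fixpoint greedy_loop (C : {set Omega} -> R) (B : R) (n : nat)
    (X : seq Omega) (E : {set Omega}) : seq Omega :=
  if n is n'.+1 then
    if E == set0 then X else
    let s := sel X E in
    if C ([set x in X] :|: [set s]) <= B
    then greedy_loop C B n' (rcons X s) (E :\ s)
    else X
  else X.

Definition greedy (C : {set Omega} -> R) (B : R) (S : {set Omega}) : seq Omega :=
  greedy_loop C B #|S| [::] S.

Fixpoint stage1_loop (C : {set Omega} -> R) (B c : R) (n : nat)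
    (X Y : seq Omega) (E : {set Omega}) : seq Omega * seq Omega :=
  if n is n'.+1 then
    if E == set0 then (X, Y) else
    let s := sel X E in
    if C ([set x in X] :|: [set s]) <= B then
      let X' := rcons X s in
      let Y' := if c < C [set x in X'] then rcons Y s else Y in
      stage1_loop C B c n' X' Y' (E :\ s)
    else (X, Y)
  else (X, Y).

Definition stage1 (rho_hat : {set Omega} -> R) (theta c : R) (S : {set Omega}) :
    seq Omega * seq Omega :=
  stage1_loop rho_hat ((1 + theta) * c) c #|S| [::] [::] S.

Variable usm : {set Omega} -> {set Omega}.

(* The state is (inputs on which USM was called so far, collection T); [revY]
   lists Y from its last item to its first. *)
Fixpoint stage2_loop (X revY : seq Omega)
    (st : seq {set Omega} * {set {set Omega}}) :
    seq {set Omega} * {set {set Omega}} :=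
  if revY is y :: revY' then
    let X' := rem y X in
    let A := [set x in X'] in
    stage2_loop X' revY' (rcons st.1 A, usm A |: st.2)
  else st.

(* [T0] is the content of the collection when the iteration starts. *)
Definition stage2 (X Y : seq Omega) (T0 : {set {set Omega}}) :
    seq {set Omega} * {set {set Omega}} :=
  if X is [::] then ([::], T0) else
  let A := [set x in X] in
  let Tstar := usm A in
  let st := stage2_loop X (rev Y) ([:: A], T0) in
  (st.1, Tstar |: st.2).

End Procedure.

(* Main.v *)
(** Monotonicity of [rho] and [rho <= rho_hat <= (1 + theta) rho] make the greedy
    sequence for [rho] a prefix of [X]: every item it accepts is accepted in
    Stage 1, and once it rejects an item every longer sequence has
    [rho_hat]-cost above [c], so every later item of [X] is also recorded in
    [Y].  Those items thus form a common suffix of [X] and [Y], and Stage 2,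
    which pops from the end, reaches the greedy set after popping exactly that
    suffix. *)

Require Import Defs.
From HB Require Import structures.
From mathcomp Require Import all_boot all_order all_algebra.
From mathcomp Require Import reals.

Set Implicit Arguments.
Unset Strict Implicit.
Unset Printing Implicit Defensive.

Import Order.TTheory GRing.Theory Num.Theory.

Local Open Scope ring_scope.

(** An optimal route for [B] also covers [A], and the visiting costs on [B :\: A] are
    nonnegative. *)
Lemma routing_cost_monotone (R : realType) (Omega : finType)
    (G : routing_graph R Omega) (rho : {set Omega} -> R) (A B : {set Omega}) :
  routing_cost G rho -> A \subset B -> rho A <= rho B.
Proof.
move=> routing sAB.
have [rA [_ minA] ->] := routing A.
have [rB [[p [routep coverp <-]] _] ->] := routing B.
apply: lerD; last by apply: minA => // s /(subsetP sAB) /coverp.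
rewrite [leRHS](big_setID A) /= (setIidPr sAB) lerDl.
by apply: sumr_ge0 => s _; apply: visit_cost_ge0.
Qed.

Lemma rem_rcons (T : eqType) (s : seq T) (x : T) :
  x \notin s -> rem x (rcons s x) = s.
Proof.
elim: s => [|y s IHs] /=; first by rewrite eqxx.
by rewrite inE negb_or eq_sym => /andP[/negPf-> /IHs->].
Qed.

Lemma set_rcons (T : finType) (s : seq T) (x : T) :
  [set y in rcons s x] = [set y in s] :|: [set x].
Proof. by apply/setP=> y; rewrite !inE mem_rcons inE orbC. Qed.

Section Loops.
Variables (R : realType) (Omega : finType).
Variable sel : seq Omega -> {set Omega} -> Omega.

(** Stage 2 pops with [rem], which deletes a first occurrence; distinctness makes this the last
    entry. *)
Lemma stage1_loop_uniq (C : {set Omega} -> R) (B c : R) n X Y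
    (E : {set Omega}) :
    (forall X' E', E' != set0 -> sel X' E' \in E') ->
    uniq X -> [disjoint X & E] ->
  uniq (stage1_loop sel C B c n X Y E).1.
Proof.
move=> sel_in; elim: n X Y E => [|n IHn] X Y E //= uX dXE.
case: ifPn => // /(sel_in X) sE; case: ifP => // _.
apply: IHn; first by rewrite rcons_uniq uX (disjointFl dXE sE).
rewrite disjoint_has; apply/hasPn => x; rewrite mem_rcons !inE.
by case: eqP => //= _ /(disjointFr dXE) ->.
Qed.

(** Quantifying over all supersets lets the hypothesis pass to longer sequences although [C] need
    not be monotone. *)
Lemma stage1_loop_over_budget (C : {set Omega} -> R) (B c : R) n X Y
    (E : {set Omega}) :
    (forall A : {set Omega}, [set x in X] :|: [set sel X E] \subset A -> c < C A) ->
  exists Z, stage1_loop sel C B c n X Y E = (X ++ Z, Y ++ Z).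
Proof.
elim: n X Y E => [|n IHn] X Y E over /=; first by exists [::]; rewrite !cats0.
case: ifP => _; first by exists [::]; rewrite !cats0.
case: ifP => _; last by exists [::]; rewrite !cats0.
rewrite set_rcons over //; set s := sel X E.
have [|Z ->] := IHn (rcons X s) (rcons Y s) (E :\ s).
  by move=> A sA; apply/over/(subset_trans _ sA); rewrite set_rcons subsetUl.
by exists (s :: Z); rewrite !cat_rcons.
Qed.

(** As [sel] ignores the evaluator, both loops agree until [rho] rejects. [Y'] may gain items before
    that, since [C] can exceed [c] while [rho] does not. *)
Lemma stage1_loop_greedy (rho C : {set Omega} -> R) (B c : R) n X Y
    (E : {set Omega}) :
    {homo rho : A1 A2 / A1 \subset A2 >-> A1 <= A2} ->
    (forall A, rho A <= C A) -> (forall A, rho A <= c -> C A <= B) ->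
  exists Z Y', stage1_loop sel C B c n X Y E
    = (greedy_loop sel rho c n X E ++ Z, Y' ++ Z).
Proof.
move=> rho_mono rho_le within.
elim: n X Y E => [|n IHn] X Y E; first by exists [::], Y; rewrite !cats0.
have [fits|exceeds] := leP (rho ([set x in X] :|: [set sel X E])) c.
  rewrite /= fits (within _ fits); case: ifP => _; last exact: IHn.
  by exists [::], Y; rewrite !cats0.
(* The count is [n.+1] because Stage 1 may still accept the very item that [rho] rejects. *)
have [|Z ->] := @stage1_loop_over_budget C B c n.+1 X Y E.
  by move=> A /rho_mono leA; apply: (lt_le_trans exceeds); apply: le_trans (rho_le A).
(* The greedy loop returns [X] both on rejection and when [E] is empty, where [sel X E] is
   arbitrary. *)
by exists Z, Y; rewrite /= leNgt exceeds /= if_same.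
Qed.

Variable usm : {set Omega} -> {set Omega}.

Lemma stage2_loop_calls_mono X revY st A :
  A \in st.1 -> A \in (stage2_loop usm X revY st).1.
Proof.
elim: revY X st => [|y revY IHY] X st //= Ast.
by apply: IHY; rewrite mem_rcons inE Ast orbT.
Qed.

(** Each pop shortens [Z] by its last item. Once [Z] is exhausted, popping the rest of [Y] only adds
    calls. *)
Lemma stage2_loop_calls_prefix P Z Y st :
    uniq (P ++ Z) -> [set x in P ++ Z] \in st.1 ->
  [set x in P] \in (stage2_loop usm (P ++ Z) (rev (Y ++ Z)) st).1.
Proof.
elim/last_ind: Z st => [|Z z IHZ] st.
  by rewrite !cats0 => _; apply: stage2_loop_calls_mono.
rewrite -!rcons_cat rev_rcons rcons_uniq /= => /andP[zPZ uPZ] _.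
by rewrite rem_rcons //; apply: IHZ; rewrite //= mem_rcons mem_head.
Qed.

(** [W] stands for [Tstar], whose call is recorded before the loop but which joins the collection
    only after it. *)
Lemma stage2_loop_usm X revY st W :
    {in st.1, forall A, usm A \in W |: st.2} ->
  {in (stage2_loop usm X revY st).1,
    forall A, usm A \in W |: (stage2_loop usm X revY st).2}.
Proof.
elim: revY X st => [|y revY IHY] X st //= st_usm.
apply: IHY => A /=; rewrite mem_rcons inE setUCA => /predU1P[->|/st_usm].
  exact: setU11.
exact: setU1r.
Qed.

End Loops.

Theorem theorem3 (R : realType) (Omega : finType)
    (f : {set Omega} -> R)
    (f_ge0 : forall A, 0 <= f A) (f_submod : submodular f)
    (G : routing_graph R Omega)
    (rho : {set Omega} -> R) (rho_routing : routing_cost G rho)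
    (c : R) (c_gt0 : 0 < c)
    (theta : R) (theta_gt0 : 0 < theta)
    (rho_hat : {set Omega} -> R) (rho_hat_approx : approximates theta rho rho_hat)
    (sel : seq Omega -> {set Omega} -> Omega) (selP : greedy_selection f sel)
    (usm : {set Omega} -> {set Omega}) (usm_sub : forall A, usm A \subset A)
    (S : {set Omega}) (T0 : {set {set Omega}})
    (X Y : seq Omega) (XY_stage1 : (X, Y) = stage1 sel rho_hat theta c S)
    (stage2_runs : X <> [::])
    (calls : seq {set Omega}) (T : {set {set Omega}})
    (T_stage2 : (calls, T) = stage2 usm X Y T0)
    (Xrho : {set Omega})
    (Xrho_greedy : Xrho = [set x in greedy sel rho c S]) :
  Xrho \in calls /\ (usm Xrho \in T /\ usm Xrho \subset Xrho).
Proof.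
have rho_mono : {homo rho : A B / A \subset B >-> A <= B}.
  by move=> A B; apply: routing_cost_monotone rho_routing.
have rho_le A : rho A <= rho_hat A by case/andP: (rho_hat_approx A).
have within A : rho A <= c -> rho_hat A <= (1 + theta) * c.
  move=> rhoA; case/andP: (rho_hat_approx A) => _ /le_trans; apply.
  by rewrite ler_pM2l // addr_gt0.
have [Z [Y' defXY]] :=
  stage1_loop_greedy sel #|S| [::] [::] S rho_mono rho_le within.
have uX : uniq X.
  rewrite -[X]/(X, Y).1 XY_stage1; apply: stage1_loop_uniq => //.
    by move=> X' E' /(selP X') [].
  by rewrite disjoint_has.
move: XY_stage1; rewrite /stage1 defXY -/(greedy sel rho c S) => -[defX defY].
have [-> ->] : calls = (stage2_loop usm X (rev Y) ([:: [set x in X]], T0)).1 /\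
    T = usm [set x in X] |: (stage2_loop usm X (rev Y) ([:: [set x in X]], T0)).2.
  by move: T_stage2; rewrite /stage2; case: (X) stage2_runs => // x s _ [-> ->].
have Xrho_called : Xrho \in (stage2_loop usm X (rev Y) ([:: [set x in X]], T0)).1.
  rewrite Xrho_greedy {}defY; move: uX; rewrite {}defX => uX.
  by apply: stage2_loop_calls_prefix; rewrite //= mem_head.
split=> //; split=> //; apply: stage2_loop_usm Xrho_called => A /=.
by rewrite inE => /eqP->; apply: setU11.
Qed.
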